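(* Let $f:\mathbb{R}\to\mathbb{R}$ be a convex function and let $A(f)=\{t\in\mathbb{R}: f(t)=\inf_{s\in\mathbb{R}} f(s)\}$. If the smallest minimizing point $\sigma(f)=\min A(f)$ exists, then for every $x\in\mathbb{R}$: $$\sigma(f)\le x \iff D^+f(x)\ge 0.$$ If the largest minimizing point $\tau(f)=\max A(f)$ exists, then for every $x\in\mathbb{R}$: $$\tau(f)\ge x \iff D^-f(x)\le 0.$$
   Context: $D^+f$ and $D^-f$ denote the right and left derivative of the convex function $f$ (they exist and are finite at every real point). That $\min A(f)$ exists means that $A(f)$ is nonempty and bounded below (then it attains its infimum, since $A(f)$ is a closed interval); similarly for $\max A(f)$. *)

(* Defs.v *)
From mathcomp Require Import all_boot all_order all_algebra.
From mathcomp Require Import all_classical all_reals all_analysis.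
Set Implicit Arguments.
Unset Strict Implicit.
Unset Printing Implicit Defensive.
Import Order.TTheory GRing.Theory Num.Theory.
Import numFieldNormedType.Exports.
Local Open Scope classical_set_scope.
Local Open Scope ring_scope.

(* The limits are junk values when the one-sided difference quotients diverge;
   for f convex on the whole line they converge at every point. *)
Definition right_derivative (R : realType) (f : R -> R) (x : R) : R :=
  lim ((f (x + h) - f x) / h @[h --> 0^'+]).

Definition left_derivative (R : realType) (f : R -> R) (x : R) : R :=
  lim ((f (x + h) - f x) / h @[h --> 0^'-]).

(* The infimum is taken in the extended reals: the real-valued [inf] is 0 on a
   set that is not bounded below, whereas here the set is empty if inf f = -oo. *)
Definition argmin (R : realType) (f : R -> R) : set R :=
  [set t | (f t)%:E = ereal_inf (range (fun s => (f s)%:E))].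

(* The least (resp. greatest) element of A; 0 if there is none. *)
Definition set_min (R : realType) (A : set R) : R := xget 0 (A `&` lbound A).

Definition set_max (R : realType) (A : set R) : R := xget 0 (A `&` ubound A).

Definition sigma (R : realType) (f : R -> R) : R := set_min (argmin f).

Definition tau (R : realType) (f : R -> R) : R := set_max (argmin f).

(* Main.v *)
Require Import Defs.
From mathcomp Require Import all_boot all_order all_algebra.
From mathcomp Require Import all_classical all_reals all_analysis.
From mathcomp Require Import ring lra.
Set Implicit Arguments.
Unset Strict Implicit.
Unset Printing Implicit Defensive.
Local Open Scope classical_set_scope.
Local Open Scope ring_scope.
Import Order.TTheory GRing.Theory Num.Theory.
Import numFieldNormedType.Exports.

(** The theorem rests on the monotonicity of the difference quotients of a
    convex function f.  Since h |-> (f (x + h) - f x) / h is nondecreasing on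
    the positive reals and bounded below by the quotient at h = -1, the right
    derivative at x exists and is the infimum of these quotients over h > 0.
    Hence it is nonnegative exactly when f x <= f y for every y > x
    ([right_derivative_ge0]).

    This condition says that x is not to the left of s, the least minimizing
    point.  If s <= x < y then x lies between a minimizing point and y, so
    f x <= f y by convexity.  If x < s then f x <= f s would make x a smaller
    minimizing point ([least_minimizer_le]).

    What remains is that the least minimizing point exists as soon as the set
    of minimizing points is nonempty and bounded below, i.e. that its infimum m
    is a minimizing point ([argmin_inf]).  This is convexity again: a
    difference quotient on the left of m bounds f from below by an affine
    function on the right of m, so f m exceeds the minimum by at most a
    constant times t - m, for minimizing points t arbitrarily close to m.

    The statement about left derivatives follows by applying the first one to
    t |-> f (- t), whose minimizing points are the opposites of those of f. *)

(** * Convexity through chords *)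

(** Convexity cleared of its denominators.  In this form all the consequences
    below are linear arithmetic, and the reflection t |-> - t acts by exchanging
    the roles of u and w. *)
Definition below_chords (R : realType) (f : R -> R) : Prop :=
  forall u v w : R, u < v -> v < w ->
    (w - u) * f v <= (w - v) * f u + (v - u) * f w.

Lemma convex_below_chords (R : realType) (f : R -> R) :
  convex_function (E := R^o) [set: R^o] f -> below_chords f.
Proof.
move=> cf u v w uv vw.
have uw : 0 < w - u by rewrite subr_gt0 (lt_trans uv).
have wu0 : w - u != 0 by rewrite gt_eqF.
pose p := (w - v) / (w - u).
have p01 : Itv.spec (@Itv.num_sem R) (Itv.Real `[0%Z, 1%Z]) p.
  have p0 : 0 <= p by apply: divr_ge0; [rewrite subr_ge0 ltW|exact: ltW].
  have p1 : p <= 1 by rewrite /p ler_pdivrMr// mul1r lerD2l lerN2 ltW.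
  by rewrite /Itv.num_sem /= num_real /= in_itv /= p0 p1.
have : f (p * u + (1 - p) * w) <= p * f u + (1 - p) * f w.
  by apply: (cf (Itv.mk p01) u w); rewrite in_setT.
have -> : p * u + (1 - p) * w = v by rewrite /p; field.
rewrite -(ler_pM2l uw) => /le_trans; apply.
by rewrite le_eqVlt; apply/orP; left; apply/eqP; rewrite /p; field.
Qed.

Lemma below_chords_opp (R : realType) (f : R -> R) :
  below_chords f -> below_chords (fun t => f (- t)).
Proof.
move=> cf u v w uv vw.
have := @cf (- w) (- v) (- u); rewrite !ltrN2 => /(_ vw uv).
by rewrite !opprK addrC (addrC (- v)) (addrC (- u) v) => /le_trans; apply; lra.
Qed.

(** * The sign of the right derivative *)

Definition difference_quotient (R : realType) (f : R -> R) (x h : R) : R :=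
  (f (x + h) - f x) / h.

Section right_derivative.
Variables (R : realType) (f : R -> R).
Hypothesis cf : below_chords f.

Local Notation quotient := (difference_quotient f).

Lemma quotient_le (x h k : R) : 0 < h -> h <= k -> quotient x h <= quotient x k.
Proof.
move=> h0; rewrite le_eqVlt => /predU1P[->//|hk].
have k0 : 0 < k := lt_trans h0 hk.
rewrite /difference_quotient ler_pdivrMr// mulrAC ler_pdivlMr//.
have := @cf x (x + h) (x + k); rewrite ltrDl ltrD2l => /(_ h0 hk); lra.
Qed.

(** The left-hand side is the difference quotient at h = -1.  It bounds those
    at h > 0 from below, so that their limit at 0 is finite; it is also the
    slope of an affine minorant of f on the right of x. *)
Lemma left_quotient_le (x h : R) : 0 < h -> f x - f (x - 1) <= quotient x h.
Proof.
move=> h0; rewrite /difference_quotient ler_pdivlMr//.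
have := @cf (x - 1) x (x + h); rewrite gtrBl ltrDl ltr01 => /(_ isT h0); lra.
Qed.

Lemma cvg_quotient (x : R) : cvg (quotient x h @[h --> 0^'+]).
Proof.
apply: nondecreasing_at_right_is_cvgr.
  near=> b => h k; rewrite !in_itv /= => /andP[h0 _] _; exact: quotient_le.
near=> b; exists (f x - f (x - 1)) => _ [h + <-].
by rewrite /= in_itv /= => /andP[h0 _]; exact: left_quotient_le.
Unshelve. all: by end_near. Qed.

(** The right derivative is the infimum of the quotients over h > 0, so it is
    nonnegative exactly when all of them are. *)
Lemma right_derivative_ge0 (x : R) :
  0 <= right_derivative f x <-> (forall y, x < y -> f x <= f y).
Proof.
split=> [D0 y xy|xmin].
  have yx : 0 < y - x by rewrite subr_gt0.
  suff : 0 <= quotient x (y - x).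
    by rewrite /difference_quotient (addrC x) subrK pmulr_lge0 ?invr_gt0// subr_ge0.
  apply: (le_trans D0); apply: limr_le; first exact: cvg_quotient.
  near=> h; apply: quotient_le; first by near: h; exact: nbhs_right_gt.
  by near: h; exact: nbhs_right_le.
apply: limr_ge; first exact: cvg_quotient.
near=> h.
have h0 : 0 < h by near: h; exact: nbhs_right_gt.
by apply: divr_ge0; [rewrite subr_ge0 xmin// ltrDl|exact: ltW].
Unshelve. all: by end_near. Qed.

(** * The least minimizing point *)

Lemma argminE (t : R) : argmin f t <-> forall s, f t <= f s.
Proof.
split=> [At s|tmin].
  rewrite -lee_fin At; apply: ereal_inf_lbound; by exists s.
rewrite /argmin /=; apply/eqP; rewrite eq_le; apply/andP; split.
  by apply: le_ereal_inf_tmp => _ [s _ <-]; rewrite lee_fin.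
by apply: ereal_inf_lbound; exists t.
Qed.

(** Write m for the infimum.  By convexity f stays, on the right of m, above the
    line through (m, f m) of slope f m - f (m - 1), so the minimum, reached at
    points t arbitrarily close to m, is at least f m minus an arbitrarily small
    quantity. *)
Lemma argmin_inf : has_inf (argmin f) -> argmin f (inf (argmin f)).
Proof.
move=> Ainf; set m := inf (argmin f); apply/argminE => s.
(* A bound for the slope; adding 1 makes it positive, so that e / c is too. *)
pose c := `|f (m - 1) - f m| + 1.
have c0 : 0 < c by rewrite ltr_wpDl.
apply/ler_addgt0Pr => e e0.
have [t At tm] := @inf_adherent _ _ (e / c) (divr_gt0 e0 c0) Ainf.
have fts := (argminE t).1 At s.
have : m <= t by apply: ge_inf => //; exact: Ainf.2.
rewrite le_eqVlt => /predU1P[mt|mt]; first by rewrite mt; lra.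
have h0 : 0 < t - m by rewrite subr_gt0.
have := left_quotient_le m h0.
rewrite /difference_quotient (addrC m (t - m)) subrK ler_pdivlMr// => slope.
have hc : (t - m) * c < e by rewrite -ltr_pdivlMr// ltrBlDl.
have abs : (t - m) * (f (m - 1) - f m) <= (t - m) * c.
  by rewrite ler_pM2l// (le_trans (ler_norm _))// lerDl.
lra.
Qed.

Lemma sigma_unique (m : R) :
  argmin f m -> lbound (argmin f) m -> sigma f = m.
Proof.
move=> Am lm; apply: xget_unique => // y [Ay ly].
by apply/eqP; rewrite eq_le lm// ly.
Qed.

Lemma sigma_inf : has_inf (argmin f) -> sigma f = inf (argmin f).
Proof.
move=> Ainf; apply: sigma_unique; first exact: argmin_inf.
by apply: ge_inf; exact: Ainf.2.
Qed.

(** On the right of m, f is nondecreasing by convexity.  A point x < m with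
    f x <= f m would be a minimizing point smaller than m. *)
Lemma least_minimizer_le (m x : R) : argmin f m -> lbound (argmin f) m ->
  m <= x <-> (forall y, x < y -> f x <= f y).
Proof.
move=> Am lm; have mmin := (argminE m).1 Am; split=> [|xmin].
  rewrite le_eqVlt => /predU1P[<- y _//|mx y xy].
  have := @cf m x y mx xy; have := mmin y => fmy chord.
  have ym : 0 < y - m by rewrite subr_gt0 (lt_trans mx).
  rewrite -(ler_pM2l ym); apply: (le_trans chord).
  have : (y - x) * f m <= (y - x) * f y by rewrite ler_wpM2l// subr_ge0 ltW.
  lra.
rewrite leNgt; apply/negP => xm.
have Ax : argmin f x by apply/argminE => s; apply: le_trans (mmin s); exact: xmin.
by have := lm x Ax; rewrite leNgt xm.
Qed.

Lemma sigma_le (x : R) : has_inf (argmin f) ->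
  sigma f <= x <-> 0 <= right_derivative f x.
Proof.
move=> Ainf; rewrite right_derivative_ge0 sigma_inf//.
by apply: least_minimizer_le; [exact: argmin_inf|apply: ge_inf; exact: Ainf.2].
Qed.

End right_derivative.

(** * Reflection *)

Section reflection.
Variables (R : realType) (f : R -> R).
Let g : R -> R := fun t => f (- t).

Lemma argmin_opp (t : R) : argmin g t <-> argmin f (- t).
Proof.
split=> /argminE tmin; apply/argminE => s; last exact: tmin.
by have := tmin (- s); rewrite /g opprK.
Qed.

Lemma has_inf_argmin_opp : has_sup (argmin f) -> has_inf (argmin g).
Proof.
move=> [[t At] [b ub]]; split.
  by exists (- t); apply/argmin_opp; rewrite opprK.
by exists (- b) => s /argmin_opp As; rewrite lerNl ub.
Qed.

Lemma tau_opp : below_chords f -> has_sup (argmin f) -> tau f = - sigma g.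
Proof.
move=> cf Asup; have Ainf := has_inf_argmin_opp Asup.
have cg : below_chords g := below_chords_opp cf.
rewrite sigma_inf//; have Am := argmin_inf cg Ainf.
have ub : ubound (argmin f) (- inf (argmin g)).
  move=> t At; rewrite lerNr; apply: ge_inf; first exact: Ainf.2.
  by apply/argmin_opp; rewrite opprK.
apply: xget_unique; first by split=> //; exact/argmin_opp.
move=> y [Ay uy]; apply/eqP; rewrite eq_le ub//= uy//.
exact/argmin_opp.
Qed.

Lemma left_derivative_opp (x : R) : below_chords f ->
  left_derivative f x = - right_derivative g (- x).
Proof.
move=> cf; rewrite /left_derivative /right_derivative.
rewrite -limN; last exact: cvg_quotient (below_chords_opp cf) _.
rewrite -{1}oppr0 at_leftN -fmap_comp.
suff -> : (fun h => (f (x + h) - f x) / h) \o -%R =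
    - (fun h => (g (- x + h) - g (- x)) / h) by [].
(* Unfold the opposite of a function into a pointwise opposite. *)
apply/funext => h /=; rewrite /GRing.opp /=.
by rewrite /g opprD !opprK invrN mulrN.
Qed.

End reflection.

Theorem theorem1 (R : realType) (f : R -> R)
    (f_convex : convex_function (E := R^o) [set: R^o] f) :
  (has_inf (argmin f) ->
     forall x : R, sigma f <= x <-> 0 <= right_derivative f x) /\
  (has_sup (argmin f) ->
     forall x : R, tau f >= x <-> left_derivative f x <= 0).
Proof.
have cf := convex_below_chords f_convex.
split=> [Ainf x|Asup x]; first exact: sigma_le.
rewrite tau_opp// left_derivative_opp// oppr_le0 lerNr.
apply: sigma_le; first exact: below_chords_opp.
exact: has_inf_argmin_opp.
Qed.
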